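(* Let $g:\mathbb{N}\to\mathbb{R}$ satisfy $g(k)\le\frac12[g(k-1)+g(k+1)]$ for all $k\ge 1$. Let $S=X_1+\cdots+X_m$ be a sum of independent Bernoulli random variables with success probabilities $\mathbb{P}(X_i=1)=p_i\in[0,1]$, and let $z=\mathbb{E}(S)=p_1+\cdots+p_m$. Let $Z$ be a Poisson random variable with mean $z$. Then $$\mathbb{E}[g(S)]\le\mathbb{E}[g(Z)].$$
   Context: $\mathbb{N}=\{0,1,2,\ldots\}$. The expectation $\mathbb{E}[g(Z)]$ is understood as an element of $(-\infty,+\infty]$ (it is well defined since a convex $g$ is bounded below by an affine function). If $z=0$, the Poisson variable with mean $0$ is the constant $0$. *)

(* Defs.v *)
From HB Require Import structures.
From mathcomp Require Import all_boot all_order all_algebra.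
From mathcomp Require Import all_classical all_reals all_analysis.

Set Implicit Arguments.
Unset Strict Implicit.
Unset Printing Implicit Defensive.

Import Order.TTheory GRing.Theory Num.Theory.

Local Open Scope classical_set_scope.
Local Open Scope ring_scope.

(* Mutual independence: the product rule over every subfamily [J], not merely
   pairwise independence. *)
Definition independent_RVs (d d' : measure_display) (T : measurableType d)
    (T' : measurableType d') (R : realType) (P : probability T R)
    (I : finType) (X : I -> {RV P >-> T'}) : Prop :=
  forall (J : {set I}) (A : I -> set T'), (forall i, measurable (A i)) ->
    P (\bigcap_(i in [set i | i \in J]) (X i @^-1` A i)) =
    (\prod_(i in J) P (X i @^-1` A i))%E.

Definition bernoulli_RV (d : measure_display) (T : measurableType d)
    (R : realType) (P : probability T R) (X : {RV P >-> bool}) (p : R) : Prop :=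
  distribution P X = bernoulli_prob p.

(* The [nat] argument of [poisson_prob] is vacuous: its body does not depend on
   it. At mean 0, [poisson_prob] is the Dirac mass at 0. *)
Definition poisson_RV (d : measure_display) (T : measurableType d)
    (R : realType) (P : probability T R) (Z : {RV P >-> nat}) (z : R) : Prop :=
  distribution P Z = poisson_prob z 0.

(* The number of successes [X_1 + ... + X_m], each boolean outcome counting as
   0 or 1. *)
Definition successes (d : measure_display) (T : measurableType d)
    (R : realType) (P : probability T R) (m : nat)
    (X : 'I_m -> {RV P >-> bool}) (w : T) : nat :=
  (\sum_(i < m) X i w)%N.

(* Main.v *)
(* Subtracting the affine function through (0, g 0) and (1, g 1), whose
   expectation depends only on the common mean z, reduces to g convex,
   nonnegative and nondecreasing.  Jensen's inequality along a tangent line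
   bounds one Bernoulli average by the Poisson average of the same mean.  A
   Bernoulli average of a convex function is again convex, so the variables can
   be replaced one at a time by Poisson ones, whose laws convolve to the Poisson
   law of mean z.  The law of S enters through its probability generating
   polynomial, the product of the (1 - p_i) + p_i 'X. *)
Require Import Defs.
From HB Require Import structures.
From mathcomp Require Import all_boot all_order all_algebra.
From mathcomp Require Import all_classical all_reals all_analysis.
From mathcomp Require Import measurable_realfun ring lra.

Import Order.TTheory GRing.Theory Num.Theory.

Local Open Scope classical_set_scope.
Local Open Scope ring_scope.

(* Unlike [poisson_pmf], whose value at mean 0 is the junk constant 1, this
   weight gives the Dirac mass at 0 when [z = 0]. *)
Definition poisson_weight (R : realType) (z : R) (k : nat) : R :=
  exp_coeff z k * expR (- z).

Definition poisson_mean (R : realType) (z : R) (f : nat -> R) : \bar R :=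
  (\sum_(k <oo) (poisson_weight R z k * f k)%:E)%E.

Definition pgf_factor (R : realType) (p : R) : {poly R} :=
  (1 - p)%:P + p *: 'X.

(** When [q] is the probability generating polynomial of a variable, this is the mean of [f] at that
    variable. *)
Definition coef_pairing (R : realType) (f : nat -> R) (q : {poly R}) : R :=
  \sum_(i < size q) q`_i * f i.

(** The mean of [f (k + B)] for [B] Bernoulli of parameter [p]. For any real [p] it is also the
    value at [k + p] of the line through the graph of [f] at [k] and [k.+1]. *)
Definition bernoulli_step (R : realType) (p : R) (f : nat -> R) (k : nat) : R :=
  (1 - p) * f k + p * f k.+1.

(** Constraining the first value and the first increment suffices: convexity makes the increments
    nondecreasing, so both signs propagate. *)
Definition convex_nondecreasing_ge0 (R : realType) (f : nat -> R) : Prop :=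
  [/\ 0 <= f 0%N, f 0%N <= f 1%N
    & forall k, f k.+1 *+ 2 <= f k + f k.+2].

Arguments poisson_weight {R}.
Arguments poisson_mean {R}.
Arguments pgf_factor {R}.
Arguments coef_pairing {R}.
Arguments bernoulli_step {R}.
Arguments convex_nondecreasing_ge0 {R}.

(** * Pairing a sequence with the coefficients of a polynomial *)

Lemma coef_pairing_widen (R : realType) (f : nat -> R) (q : {poly R}) n :
  (size q <= n)%N -> coef_pairing f q = \sum_(i < n) q`_i * f i.
Proof.
move=> qn; rewrite /coef_pairing (big_ord_widen n (fun i => q`_i * f i))//.
rewrite big_mkcond; apply: eq_bigr => i _; case: ifPn => //.
by rewrite -leqNgt => qi; rewrite nth_default// mul0r.
Qed.

Lemma coef_pairingD (R : realType) (f : nat -> R) (q r : {poly R}) :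
  coef_pairing f (q + r) = coef_pairing f q + coef_pairing f r.
Proof.
rewrite (coef_pairing_widen _ f (q + r) _ (size_polyD q r)).
rewrite (coef_pairing_widen _ f q _ (leq_maxl _ (size r))).
rewrite (coef_pairing_widen _ f r _ (leq_maxr (size q) _)).
by rewrite -big_split; apply: eq_bigr => i _; rewrite coefD mulrDl.
Qed.

Lemma coef_pairingZ (R : realType) (f : nat -> R) (c : R) (q : {poly R}) :
  coef_pairing f (c *: q) = c * coef_pairing f q.
Proof.
rewrite (coef_pairing_widen _ f (c *: q) _ (size_scale_leq c q)).
by rewrite mulr_sumr; apply: eq_bigr => i _; rewrite coefZ mulrA.
Qed.

Lemma coef_pairing_sum (R : realType) (f : nat -> R) (I : finType)
    (q : I -> {poly R}) :
  coef_pairing f (\sum_i q i) = \sum_i coef_pairing f (q i).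
Proof.
apply: (big_morph _ (coef_pairingD R f)).
by rewrite /coef_pairing size_poly0 big_ord0.
Qed.

Lemma coef_pairingXn (R : realType) (f : nat -> R) n :
  coef_pairing f 'X^n = f n.
Proof.
rewrite /coef_pairing size_polyXn big_ord_recr/= big1 ?add0r => [|i _].
  by rewrite coefXn eqxx mul1r.
by rewrite coefXn (ltn_eqF (ltn_ord i)) mul0r.
Qed.

Lemma coef_pairingMX (R : realType) (f : nat -> R) (q : {poly R}) :
  coef_pairing f (q * 'X) = coef_pairing (f \o succn) q.
Proof.
rewrite (coef_pairing_widen _ f (q * 'X) (size q).+1); last first.
  rewrite (leq_trans (size_polyMleq _ _))// size_polyX.
  by rewrite addn2.
rewrite big_ord_recl coefMX mul0r add0r; apply: eq_bigr => i _.
by rewrite coefMX.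
Qed.

Lemma coef_pairing_lin (R : realType) (f g h : nat -> R) (a b : R)
    (q : {poly R}) :
  (forall k, h k = a * f k + b * g k) ->
  coef_pairing h q = a * coef_pairing f q + b * coef_pairing g q.
Proof.
move=> hE; rewrite /coef_pairing !mulr_sumr -big_split; apply: eq_bigr => i _.
by rewrite hE /=; move: (q`_i) => c; ring.
Qed.

(** Multiplying by the factor adds an independent Bernoulli variable. Averaging over that variable
    first transposes the multiplication into an operator on [f]. *)
Lemma coef_pairing_pgf_factor (R : realType) (f : nat -> R) (p : R)
    (q : {poly R}) :
  coef_pairing f (pgf_factor p * q) = coef_pairing (bernoulli_step p f) q.
Proof.
rewrite /pgf_factor mulrDl mul_polyC -scalerAl coef_pairingD !coef_pairingZ.
rewrite [_ * q]mulrC coef_pairingMX.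
by rewrite (coef_pairing_lin R f (f \o succn) (bernoulli_step p f) (1 - p) p).
Qed.

(** * Convex sequences *)

Lemma convex_nondecreasing (R : realType) (f : nat -> R) k :
  convex_nondecreasing_ge0 f -> 0 <= f k /\ f k <= f k.+1.
Proof.
case=> f0 f01 cf; elim: k => // k [fk fk1]; move: (cf k) => ?.
by split; lra.
Qed.

Lemma convex_tangent (R : realType) (f : nat -> R) k j :
  convex_nondecreasing_ge0 f -> f k + j%:R * (f k.+1 - f k) <= f (k + j)%N.
Proof.
move=> [f0 f01 cf].
(* The induction on [j] also needs that the increment at [k + j] is at least the slope at [k]. *)
suff [] : f k + j%:R * (f k.+1 - f k) <= f (k + j)%N /\
   f k.+1 - f k <= f (k + j).+1 - f (k + j)%N by [].
elim: j => [|j [IH1 IH2]]; first by rewrite addn0 mul0r; split; lra.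
by rewrite addnS; move: (cf (k + j)%N) => ?; rewrite -natr1; split; lra.
Qed.

Lemma convex_bernoulli_step (R : realType) (f : nat -> R) (p : R) :
  0 <= p <= 1 -> convex_nondecreasing_ge0 f ->
  convex_nondecreasing_ge0 (bernoulli_step p f).
Proof.
move=> /andP[p0 p1] cf; have p'0 : 0 <= 1 - p by rewrite subr_ge0.
have [f0 f01] := convex_nondecreasing _ _ 0%N cf.
have [f1 f12] := convex_nondecreasing _ _ 1%N cf.
case: cf => _ _ cf; rewrite /bernoulli_step; split.
- by rewrite addr_ge0// mulr_ge0.
- by rewrite lerD ?ler_wpM2l.
- move=> k; have /(ler_wpM2l p'0) := cf k; have /(ler_wpM2l p0) := cf k.+1.
  lra.
Qed.

(** * Poisson weights *)

Section poisson_weight_theory.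
Context (R : realType).
Implicit Types (z a b : R) (f : nat -> R).

Lemma poisson_weight_ge0 z k : 0 <= z -> 0 <= poisson_weight z k.
Proof. by move=> z0; rewrite mulr_ge0 ?expR_ge0// exp_coeff_ge0. Qed.

Lemma poisson_weight0 k : poisson_weight (0 : R) k = (k == 0%N)%:R.
Proof.
rewrite /poisson_weight /exp_coeff/= oppr0 expR0 mulr1.
by case: k => [|k]; rewrite ?expr0 ?fact0 ?divr1// expr0n mul0r.
Qed.

Lemma poisson_weight_succ z k :
  poisson_weight z k.+1 * k.+1%:R = z * poisson_weight z k.
Proof.
rewrite /poisson_weight /exp_coeff/= exprS factS natrM; field.
by rewrite nat1r !pnatr_eq0 -lt0n fact_gt0.
Qed.

(** The binomial theorem, with [n!] cancelled against the binomial coefficients. *)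
Lemma poisson_weight_conv a b n :
  poisson_weight (a + b) n =
  \sum_(i < n.+1) poisson_weight a i * poisson_weight b (n - i)%N.
Proof.
(* [exprDn] gives the exponent [i] to its second summand, hence the swap of [a] and [b]. *)
rewrite /poisson_weight /exp_coeff/= [a + b]addrC exprDn mulr_suml mulr_suml.
apply: eq_bigr => i _; have in_ : (i <= n)%N by rewrite -ltnS.
have fn0 m : (m`!%:R : R) != 0 by rewrite pnatr_eq0 -lt0n fact_gt0.
rewrite opprD expRD.
have /(congr1 (fun m => m%:R : R)) := bin_fact in_.
rewrite !natrM -mulr_natr => <-.
have bn0 : ('C(n, i)%:R : R) != 0 by rewrite pnatr_eq0 -lt0n bin_gt0.
by field; rewrite !fn0 bn0.
Qed.

End poisson_weight_theory.

(** * Poisson expectations as series *)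

Section poisson_mean_theory.
Local Open Scope ereal_scope.
Context (R : realType).
Implicit Types (z a b : R) (f : nat -> R).

Let term_ge0 z f k : (0 <= z)%R -> (forall k, 0 <= f k)%R ->
  0 <= (poisson_weight z k * f k)%:E.
Proof. by move=> z0 f0; rewrite lee_fin mulr_ge0// poisson_weight_ge0. Qed.

Lemma poisson_mean1 z : (0 <= z)%R -> poisson_mean z (fun=> 1%R) = 1.
Proof.
move=> z0; rewrite [RHS](_ : _ = (expR (- z))%:E * (expR z)%:E); last first.
  by rewrite -EFinM expRN mulVf ?gt_eqF ?expR_gt0.
rewrite /poisson_mean; under eq_eseriesr.
  move=> k _; rewrite mulr1 /poisson_weight EFinM muleC; over.
rewrite /= nneseriesZl/=; last first.
  by move=> k _; rewrite lee_fin exp_coeff_ge0.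
congr *%E; rewrite /expR -EFin_lim; last exact: is_cvg_series_exp_coeff.
by apply/congr_lim/funext => n/=; rewrite /series/= -sumEFin.
Qed.

Lemma poisson_meanZ z c f : (0 <= z)%R -> (0 <= c)%R ->
    (forall k, 0 <= f k)%R ->
  poisson_mean z (fun k => c * f k)%R = c%:E * poisson_mean z f.
Proof.
move=> z0 c0 f0; rewrite /poisson_mean -nneseriesZl; last first.
  by move=> k _; exact: term_ge0.
by apply: eq_eseriesr => k _; rewrite -EFinM mulrCA.
Qed.

Lemma poisson_meanD z f g : (0 <= z)%R ->
    (forall k, 0 <= f k)%R -> (forall k, 0 <= g k)%R ->
  poisson_mean z (fun k => f k + g k)%R = poisson_mean z f + poisson_mean z g.
Proof.
move=> z0 f0 g0; rewrite /poisson_mean -nneseriesD.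
- by apply: eq_eseriesr => k _; rewrite -EFinD mulrDr.
- by move=> k _ _; exact: term_ge0.
- by move=> k _ _; exact: term_ge0.
Qed.

Lemma le_poisson_mean z f g : (0 <= z)%R -> (forall k, 0 <= f k)%R ->
  (forall k, f k <= g k)%R -> poisson_mean z f <= poisson_mean z g.
Proof.
move=> z0 f0 fg; apply: lee_nneseries => [k _ _|k _]; first exact: term_ge0.
by rewrite lee_fin ler_wpM2l// poisson_weight_ge0.
Qed.

(** The term at 0 vanishes; shifting the index by one turns the rest into [z] times the total
    mass. *)
Lemma poisson_mean_id z : (0 <= z)%R -> poisson_mean z (fun k => k%:R) = z%:E.
Proof.
move=> z0; rewrite /poisson_mean nneseries_recl//; last first.
  by move=> k _; apply: (term_ge0 z (fun k => k%:R)).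
rewrite mulr0 add0e -nneseries_addn; last first.
  by move=> k; apply: (term_ge0 z (fun k => k%:R)).
under eq_eseriesr do rewrite addn1 poisson_weight_succ -[poisson_weight _ _]mulr1.
rewrite (eq_eseriesr (g := fun k => z%:E * (poisson_weight z k * 1)%:E)).
  rewrite nneseriesZl; last by move=> k _; apply: (term_ge0 z (fun=> 1%R)).
  by rewrite -[X in _ * X]/(poisson_mean z (fun=> 1%R)) poisson_mean1// mule1.
by move=> k _; rewrite EFinM.
Qed.

(* Jensen's inequality for the Poisson law, by the tangent line at [k]. *)
Lemma bernoulli_step_le_poisson_mean z f k : (0 <= z)%R ->
    convex_nondecreasing_ge0 f ->
  (bernoulli_step z f k)%:E <= poisson_mean z (fun j => f (k + j)%N).
Proof.
move=> z0 cf; have [fk fk1] := convex_nondecreasing R f k cf.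
have d0 : (0 <= f k.+1 - f k)%R by rewrite subr_ge0.
(* The mean of the tangent line is its value at [k + z], which is the left-hand side. Its slope is
   nonnegative because [f] is nondecreasing, so the rules for nonnegative series apply. *)
apply: (@le_trans _ _
    (poisson_mean z (fun j => f k * 1 + (f k.+1 - f k) * j%:R)%R)).
  rewrite poisson_meanD//; [|by move=> j; rewrite mulr_ge0..].
  rewrite !poisson_meanZ// poisson_mean1// poisson_mean_id// -!EFinM -EFinD.
  by rewrite lee_fin /bernoulli_step; lra.
apply: le_poisson_mean => // j; first by rewrite addr_ge0 ?mulr_ge0.
by rewrite mulr1 mulrC; exact: convex_tangent.
Qed.

(** A sum of independent Poisson variables is Poisson: Tonelli, then the convolution of the
    weights. *)
Lemma poisson_mean_conv a b f : (0 <= a)%R -> (0 <= b)%R ->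
    (forall k, 0 <= f k)%R ->
  \sum_(i <oo) (poisson_weight a i)%:E * poisson_mean b (fun j => f (i + j)%N) =
  poisson_mean (a + b) f.
Proof.
move=> a0 b0 f0.
(* Here [k] stands for the total [i + j]. Extending by 0 for [k < i] lets both indices range over
   all of [nat], so that the sums can be interchanged. *)
pose F i k := if (i <= k)%N then
  (poisson_weight a i * poisson_weight b (k - i)%N * f k)%:E else 0.
have F0 i k : 0 <= F i k.
  rewrite /F; case: ifPn => // _.
  by rewrite lee_fin mulr_ge0// mulr_ge0 ?poisson_weight_ge0.
transitivity (\sum_(i <oo) \sum_(k <oo) F i k).
  apply: eq_eseriesr => i _; rewrite /poisson_mean -nneseriesZl; last first.
    by move=> k _; apply: (term_ge0 b (fun j => f (i + j)%N)).
  rewrite (eq_eseriesr (g := fun j => F i (j + i)%N)); last first.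
    by move=> j _; rewrite /F leq_addl addnK [(j + i)%N]addnC -mulrA EFinM.
  rewrite nneseries_addn// eseries_cond eseries_mkcond.
  by apply: eq_eseriesr => k _; rewrite /F/=; case: (i <= k)%N.
rewrite nneseries_interchange//; apply: eq_eseriesr => k _.
rewrite (nneseries_split 0 k.+1)// add0n [X in _ + X]eseries0 ?adde0.
  rewrite big_mkord poisson_weight_conv mulr_suml -sumEFin.
  by apply: eq_bigr => i _; rewrite /F -ltnS ltn_ord.
by move=> i ki _; rewrite /F leqNgt ki.
Qed.

(** Induction on [ps] with [f] general, since peeling off [p] replaces [f] by
    [bernoulli_step p f]. *)
Lemma coef_pairing_prod_pgf_factor_le (ps : seq R) f :
    all (fun p => 0 <= p <= 1)%R ps -> convex_nondecreasing_ge0 f ->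
  (coef_pairing f (\prod_(p <- ps) pgf_factor p))%:E <=
  poisson_mean (\sum_(p <- ps) p)%R f.
Proof.
elim: ps f => [|p ps IH] f /=.
  move=> _ cf; rewrite !big_nil -(expr0 'X%R) coef_pairingXn.
  (* With no variables left, the term at 0 alone already equals [f 0]. *)
  rewrite /poisson_mean nneseries_recl//; last first.
    move=> k _; apply: term_ge0 => // j; exact: (convex_nondecreasing _ _ _ cf).1.
  rewrite poisson_weight0 mul1r leeDl// nneseries_ge0// => k _ _.
  apply: term_ge0 => // j; exact: (convex_nondecreasing _ _ _ cf).1.
move=> /andP[p01 ps01] cf; have /andP[p0 _] := p01.
have f0 j : (0 <= f j)%R := (convex_nondecreasing _ _ _ cf).1.
have s0 : (0 <= \sum_(p <- ps) p)%R.
  rewrite big_seq sumr_ge0// => q qps.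
  by have /andP[] := allP ps01 _ qps.
rewrite !big_cons coef_pairing_pgf_factor.
apply: (le_trans (IH _ ps01 (convex_bernoulli_step _ _ _ p01 cf))).
(* Conditioning on the Poisson variable of mean [\sum_(p <- ps) p] leaves, for each of its values
   [k], Jensen's inequality at [k] with mean [p]. *)
rewrite addrC -poisson_mean_conv//; apply: lee_nneseries => [k _ _|k _].
  apply: term_ge0 => // j.
  exact: (convex_nondecreasing _ _ _ (convex_bernoulli_step _ _ _ p01 cf)).1.
rewrite EFinM lee_wpmul2l// ?lee_fin ?poisson_weight_ge0//.
exact: bernoulli_step_le_poisson_mean.
Qed.

End poisson_mean_theory.

(** * Expectations with possibly infinite values *)

Lemma integralD_ge0 d (T : measurableType d) (R : realType)
    (mu : {measure set T -> \bar R}) (f h : T -> R) :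
  mu.-integrable setT (EFin \o f) -> measurable_fun setT h ->
  (forall x, 0 <= h x) ->
  (\int[mu]_x (f x + h x)%:E =
   \int[mu]_x (f x)%:E + \int[mu]_x (h x)%:E)%E.
Proof.
move=> intf mh h0; have /measurable_EFinP mf := measurable_int _ intf.
(* Since [f] may change sign and [h] may have infinite integral, additivity is obtained by splitting
   into positive and negative parts. *)
pose g x := (f x + h x)%:E; pose F x := (f x)%:E; pose H x := (h x)%:E.
have mg : measurable_fun setT g by exact/measurable_EFinP/measurable_funD.
have mF : measurable_fun setT F by exact/measurable_EFinP.
have mH : measurable_fun setT H by exact/measurable_EFinP.
have pnf : (\int[mu]_x F^\+ x)%E \is a fin_num by exact: integrable_pos_fin_num.
have nnf : (\int[mu]_x F^\- x)%E \is a fin_num by exact: integrable_neg_fin_num.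
(* Adding the nonnegative [h] can only shrink the negative part, so that of [g] is dominated by that
   of [f]. *)
have nng : (\int[mu]_x g^\- x)%E \is a fin_num.
  rewrite ge0_fin_numE; last exact: integral_ge0.
  apply: le_lt_trans (_ : (\int[mu]_x F^\- x < +oo)%E); last first.
    by rewrite -ge0_fin_numE// integral_ge0.
  apply: ge0_le_integral => //; [exact: measurable_funeneg..|] => x _.
  by apply: (funeneg_le (D := setT)); rewrite ?inE// => y _;
    rewrite lee_fin lerDl.
(* All the functions here are nonnegative, so the pointwise identity integrates without finiteness
   conditions; the three finite integrals are then moved across. *)
have : (\int[mu]_x g^\+ x + \int[mu]_x F^\- x =
        \int[mu]_x g^\- x + (\int[mu]_x F^\+ x + \int[mu]_x H x))%E.
  have H0 x : (0 <= H x)%E by rewrite lee_fin.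
  have mgp := measurable_funepos mg; have mgn := measurable_funeneg mg.
  have mFp := measurable_funepos mF; have mFn := measurable_funeneg mF.
  rewrite -!ge0_integralD//; last 2 first.
  - by move=> x _; rewrite adde_ge0.
  - exact: emeasurable_funD.
  apply: eq_integral => x _; rewrite !funeposE !funenegE -!EFinN -!EFin_max.
  rewrite -!EFinD; congr EFin.
  by move: (h0 x) => ?; rewrite /Num.max; do 4?case: ifP => ?; lra.
move=> key; rewrite [LHS]integralE [X in (_ = X + _)%E]integralE.
rewrite -/g -/F -/H; move: pnf nnf nng key.
case: (\int[mu]_x F^\+ x)%E => // Fp _; case: (\int[mu]_x F^\- x)%E => // Fn _.
case: (\int[mu]_x g^\- x)%E => // gn _.
case: (\int[mu]_x g^\+ x)%E => [gp||]; case: (\int[mu]_x H x)%E => [H'||] //=.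
by move=> -[?]; congr EFin; lra.
Qed.

(** The affine minorant contributes a finite term depending on [N] only through its mean [z], hence
    the same term for [S] and for the Poisson variable. *)
Lemma expectation_affine_split d (T : measurableType d) (R : realType)
    (P : probability T R) (N : T -> nat) (g : nat -> R) (z a b : R) :
  measurable_fun setT N -> z%:E = ('E_P[fun w => (N w)%:R])%E ->
  (forall k, a + b * k%:R <= g k) ->
  ('E_P[fun w => g (N w)] =
   (a + b * z)%:E + 'E_P[fun w => (g (N w) - (a + b * (N w)%:R))%R])%E.
Proof.
move=> mN + ag; rewrite unlock => zE.
have mf (f : nat -> R) : measurable_fun setT (fun w => f (N w)).
  exact: (measurableT_comp (_ : measurable_fun setT f) mN).
(* The expectation being the real number [z] is what makes the nonnegative [N] integrable. *)
have intN : P.-integrable setT (EFin \o (fun w => (N w)%:R)).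
  apply/integrableP; split; first exact/measurable_EFinP/mf.
  rewrite (_ : \int[P]_x _ = z%:E)%E ?ltry// zE; apply: eq_integral => w _.
  by rewrite /= ger0_norm.
have intbN : P.-integrable setT (fun w => b%:E * (N w)%:R%:E)%E.
  exact: integrableZl.
have intL : P.-integrable setT (EFin \o (fun w => a + b * (N w)%:R)).
  apply: eq_integrable (integrableD measurableT
    (finite_measure_integrable_cst P a measurableT) intbN) => //.
rewrite (eq_integral (fun w =>
  ((a + b * (N w)%:R) + (g (N w) - (a + b * (N w)%:R)))%:E)); last first.
  by move=> w _; rewrite addrC subrK.
rewrite integralD_ge0//; last 2 first.
- exact: (mf (fun k => g k - (a + b * k%:R))).
- by move=> w; rewrite subr_ge0.
congr (_ + _)%E; rewrite (eq_integral (fun w => a%:E + b%:E * (N w)%:R%:E)%E)//.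
rewrite integralD//; last exact: finite_measure_integrable_cst.
by rewrite integral_cst//= probability_setT mule1 integralZl// -zE.
Qed.

Lemma expectation_poisson d (T : measurableType d) (R : realType)
    (Q : probability T R) (Z : {RV Q >-> nat}) (z : R) (f : nat -> R) :
  poisson_RV Z z -> 0 <= z -> (forall k, 0 <= f k) ->
  'E_Q[fun w => f (Z w)]%E = poisson_mean z f.
Proof.
move=> ZE z0 f0; rewrite unlock.
transitivity (\int[distribution Q Z]_k (f k)%:E)%E.
  by rewrite ge0_integral_distribution// => k; rewrite lee_fin.
have <- : \bigcup_k [set k] = [set: nat] by rewrite bigcup_imset1 image_id.
rewrite ge0_integral_bigcup//; last 2 first.
  by move=> x _; rewrite lee_fin.
  by move=> i j _ _ [x [/= -> ->]].
apply: eq_eseriesr => k _.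
rewrite (eq_integral (cst (f k)%:E)); last by move=> x /[!inE]/= ->.
rewrite (_ : integral _ _ _ = (f k)%:E * distribution Q Z [set k])%E; last first.
  exact: integral_cst.
rewrite muleC EFinM ZE; congr (_ * _)%E.
(* For [z = 0] the law is given by a separate Dirac branch, matched with [poisson_weight0]. *)
rewrite /poisson_prob; case: ifPn => [zgt0|].
  by rewrite esum_set1 ?lee_fin ?poisson_pmf_ge0// /poisson_pmf zgt0.
rewrite -leNgt => zle0; have -> : z = 0 by apply/eqP; rewrite eq_le zle0.
by rewrite poisson_weight0 diracE in_set1 eq_sym.
Qed.

(** * The law of a sum of independent Bernoulli variables *)

Section bernoulli_sum.
Context (d : measure_display) (T : measurableType d) (R : realType)
  (P : probability T R) (m : nat) (p : 'I_m -> R).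
Hypothesis p01 : forall i, 0 <= p i <= 1.
Variable X : 'I_m -> {RV P >-> bool}.
Hypothesis bernoulli_X : forall i, bernoulli_RV (X i) (p i).

Lemma bernoulli_RV_pmf i b :
  P (X i @^-1` [set b]) = (bernoulli_pmf (p i) b)%:E.
Proof.
rewrite -[LHS]/(distribution P (X i) [set b]) bernoulli_X /bernoulli_prob p01.
by rewrite fsbig_set1.
Qed.

Lemma measurable_successes : measurable_fun setT (successes X).
Proof.
rewrite /successes; elim: (index_enum _) => [|i s IH].
  by under eq_fun do rewrite big_nil; exact: measurable_cst.
under eq_fun do rewrite big_cons; apply: measurable_fun_addn => //.
exact: (measurableT_comp (_ : measurable_fun setT nat_of_bool)).
Qed.

Lemma expectation_successes :
  'E_P[fun w => (successes X w)%:R]%E = (\sum_(i < m) p i)%:E.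
Proof.
rewrite unlock (eq_integral (fun w => \sum_(i < m) (\1_(X i @^-1` [set true]) w)%:E)%E).
  rewrite ge0_integral_sum//; last first.
    move=> i; apply/measurable_EFinP/measurable_indic.
    exact: measurable_funPTI.
  rewrite -sumEFin; apply: eq_bigr => i _.
  have mXi : measurable (X i @^-1` [set true]) by exact: measurable_funPTI.
  by rewrite integral_indic//= setIT bernoulli_RV_pmf.
move=> w _; rewrite /successes natr_sum sumEFin; congr EFin.
apply: eq_bigr => i _; rewrite indicE; congr (nat_of_bool _)%:R.
by apply/idP/idP => [|/set_mem]; first by move=> Xiw; exact/mem_set.
Qed.

(** Both sides expand into a sum over the outcomes in [{0,1}^m]: the left by partitioning [T], the
    right by distributing the product. *)
Lemma expectation_comp_successes (f : nat -> R) :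
  independent_RVs X -> (forall k, 0 <= f k) ->
  'E_P[fun w => f (successes X w)]%E =
  (coef_pairing f (\prod_(i < m) pgf_factor (p i)))%:E.
Proof.
move=> indX f0.
(* [E s] is the event that the outcome vector is [s]; the full index set is used so that the product
   rule gives its probability. *)
pose E (s : {ffun 'I_m -> bool}) :=
  \bigcap_(i in [set i | i \in [set: 'I_m]%SET]) (X i @^-1` [set s i]).
pose n (s : {ffun 'I_m -> bool}) := (\sum_i s i)%N.
have mE s : measurable (E s).
  apply: fin_bigcap_measurable => // i _; exact: measurable_funPTI.
have PE s : P (E s) = (\prod_i bernoulli_pmf (p i) (s i))%:E.
  rewrite /E indX// -prodEFin; apply: eq_big => i; first by rewrite inE.
  by rewrite bernoulli_RV_pmf.
rewrite unlock (eq_integral (fun w => \sum_s (f (n s) * \1_(E s) w)%:E)%E).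
  rewrite ge0_integral_sum//; last 2 first.
  - by move=> s; apply/measurable_EFinP; exact: measurable_funM.
  - by move=> s w _; rewrite lee_fin mulr_ge0.
  under eq_bigr => s _.
    rewrite (integralZl_indic measurableT (fun=> E s))//; last first.
      by move=> fs; have := f0 (n s); rewrite leNgt fs.
    rewrite integral_indic//= setIT PE -EFinM; over.
  rewrite sumEFin; congr EFin.
  under [in RHS]eq_bigr => i _.
    (* Written as a sum over [bool], the factors distribute into a sum over functions
       ['I_m -> bool]. *)
    rewrite (_ : pgf_factor (p i) =
      \sum_(b : bool) bernoulli_pmf (p i) b *: 'X^b); last first.
      by rewrite big_bool /pgf_factor/= expr0 expr1 -alg_polyC addrC.
    over.
  rewrite bigA_distr_bigA coef_pairing_sum; apply: eq_bigr => s _.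
  by rewrite scaler_prod prodrXr coef_pairingZ coef_pairingXn mulrC.
(* Exactly one of the events contains [w], the one indexed by its own outcome vector. *)
move=> w _; pose s0 := [ffun i => X i w].
rewrite (bigD1 s0)//= big1 ?adde0 => [|s ss0].
  rewrite indicE mem_set ?mulr1; last by move=> i _; rewrite /= ffunE.
  by congr (f _)%:E; apply: eq_bigr => i _; rewrite ffunE.
rewrite indicE memNset ?mulr0// => Es; case/eqP: ss0; apply/ffunP => i.
by rewrite ffunE -(Es i)//= inE.
Qed.

End bernoulli_sum.

Theorem proposition12 (R : realType) (g : nat -> R)
    (convex_g : forall k : nat, (1 <= k)%N ->
      g k <= 2^-1 * (g k.-1 + g k.+1))
    (d : measure_display) (T : measurableType d) (P : probability T R)
    (m : nat) (p : 'I_m -> R) (p01 : forall i, 0 <= p i <= 1)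
    (X : 'I_m -> {RV P >-> bool})
    (bernoulli_X : forall i, bernoulli_RV (X i) (p i))
    (independent_X : independent_RVs X)
    (z : R) (zE : z%:E = ('E_P[fun w => (successes X w)%:R])%E)
    (d' : measure_display) (T' : measurableType d') (Q : probability T' R)
    (Z : {RV Q >-> nat}) (poisson_Z : poisson_RV Z z) :
  ('E_P[fun w => g (successes X w)] <= 'E_Q[fun w => g (Z w)])%E.
Proof.
(* [h] vanishes at 0 and 1, so both conditions at the origin hold with equality. *)
pose b := g 1%N - g 0%N; pose h k := g k - (g 0%N + b * k%:R).
have cvx_h : convex_nondecreasing_ge0 h.
  split; rewrite /h; [by rewrite /b; lra..|move=> k].
  have /= := convex_g k.+1 isT; rewrite -[k.+2%:R]natr1 -[k.+1%:R]natr1.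
  lra.
have h0 k : 0 <= h k := (convex_nondecreasing _ _ k cvx_h).1.
have gL k : g 0%N + b * k%:R <= g k by rewrite -subr_ge0; exact: h0.
have zp : z = \sum_(i < m) p i.
  by apply: EFin_inj; rewrite zE (expectation_successes _ _ _ _ _ _ p01).
have z0 : 0 <= z by rewrite zp sumr_ge0// => i _; have /andP[] := p01 i.
have meanZ : z%:E = ('E_Q[fun w => (Z w)%:R])%E.
  rewrite (expectation_poisson _ _ _ _ _ _ (fun k => k%:R) poisson_Z z0)//.
  by rewrite poisson_mean_id.
rewrite (expectation_affine_split _ _ _ _ _ _ _ _ _ _ zE gL); last first.
  exact: measurable_successes.
rewrite (expectation_affine_split _ _ _ _ _ _ _ _ _ _ meanZ gL)//.
(* The common affine term drops out, leaving the inequality for [h]. *)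
rewrite leeD2l// (expectation_poisson _ _ _ _ _ _ h poisson_Z z0)//.
rewrite (expectation_comp_successes _ _ _ _ _ _ p01 _ bernoulli_X h)//.
have := coef_pairing_prod_pgf_factor_le R [seq p i | i <- index_enum 'I_m] h.
rewrite !big_map -zp; apply => //.
by apply/allP => _ /mapP[i _ ->].
Qed.
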